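(* Let $G$ be an $n$-dimensional torus with Lie algebra $\mathfrak g$. Let $\Delta^+,\Delta^-\subseteq\mathfrak g^*$ be unimodular polytopes of dimension $n$ such that $F:=\Delta^+\cap\Delta^-$ is a facet of each of them, and suppose that $\Delta^+$ and $\Delta^-$ are mergeable along $F$. Set $\Delta:=\Delta^+\cup\Delta^-$. Then: (1) $\Delta$ is a polytope; (2) $\Delta$ is unimodular and $\mathrm{Vert}(\Delta)=\big(\mathrm{Vert}(\Delta^+)\cup\mathrm{Vert}(\Delta^-)\big)\setminus\mathrm{Vert}(F)$; (3) the affine hyperplane $A$ containing $F$ intersects $\Delta$ integrally transversely.
   Context: $\mathfrak g_{\mathbb Z}=\ker(\exp:\mathfrak g\to G)$ is the integral lattice and $\mathfrak g_{\mathbb Z}^*=\{\xi\in\mathfrak g^*\mid \xi(\mathfrak g_{\mathbb Z})\subseteq\mathbb Z\}$ the weight lattice. $\mathrm{Vert}(P)$ is the set of vertices of $P$; a facet is a face of codimension one. For a polytope $P\subseteq\mathfrak g^*$ and $\xi\in P$: $C_\xi P=\mathrm{Cone}(P-\xi)$ is the local cone; if $F'$ is the unique face containing $\xi$ in its relative interior, $L_\xi P=\mathrm{Span}_{\mathbb R}(F'-\xi)$; $\mathrm{dir}(P)$ is the linear subspace of which the affine hull of $P$ is a translate. $P$ is rational if it is an intersection of finitely many half-spaces $\{\xi\mid\langle\xi,v_i\rangle\ge c_i\}$ with $v_i\in\mathfrak g_{\mathbb Z}$, $c_i\in\mathbb R$. A rational polytope $P$ is unimodular if for every vertex $\xi$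 the cone $C_\xi P$ is the conic hull of a $\mathbb Z$-basis of $\mathfrak g_{\mathbb Z}^*\cap\mathrm{dir}(P)$. Mergeability: for each vertex $\eta\in\mathrm{Vert}(F)$, the cones $C_\eta\Delta^+$ and $C_\eta\Delta^-$ share the facet $C_\eta F$, so the two $\mathbb Z$-bases of $\mathfrak g_{\mathbb Z}^*$ generating them (the primitive edge vectors at $\eta$) have $n-1$ elements $e_1,\dots,e_{n-1}$ in common (generating $C_\eta F$); let $e_n^{(+)}$, $e_n^{(-)}$ be the remaining basis vector for $C_\eta\Delta^+$, $C_\eta\Delta^-$ respectively. $\Delta^+$ and $\Delta^-$ are mergeable along $F$ if $e_n^{(-)}=-e_n^{(+)}$ for every vertex $\eta$ of $F$. A translate $A$ of a rational subspace $B$ (one spanned by $B\cap\mathfrak g_{\mathbb Z}^*$) intersects a rational polytope $\Delta$ integrally transversely if for every $\xi\in A\cap\Delta$ $$(B\cap\mathfrak g_{\mathbb Z}^* )+(L_\xi\Delta\cap\mathfrak g_{\mathbb Z}^* )=(B\cap\mathfrak g_{\mathbb Z}^* )+(\mathrm{dir}(\Delta)\cap\mathfrak g_{\mathbb Z}^* ).$$ *)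

(* Defs.v *)
From HB Require Import structures.
From mathcomp Require Import all_boot all_order all_algebra.
From mathcomp Require Import boolp classical_sets reals.

Set Implicit Arguments.
Unset Strict Implicit.
Unset Printing Implicit Defensive.

Import Order.TTheory GRing.Theory Num.Theory.
Local Open Scope classical_set_scope.
Local Open Scope ring_scope.

Section Hulls.
Context {R : realType} {V : vectType R}.
Implicit Types (S : set V) (U : {vspace V}) (x y v : V).

Definition lin_span S : set V :=
  [set v | exists (k : nat) (c : 'I_k -> R) (s : 'I_k -> V),
     (forall i, S (s i)) /\ v = \sum_i c i *: s i].

Definition aff_hull S : set V :=
  [set v | exists (k : nat) (c : 'I_k -> R) (s : 'I_k -> V),
     [/\ forall i, S (s i), \sum_i c i = 1 & v = \sum_i c i *: s i]].

Definition conv_hull S : set V :=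
  [set v | exists (k : nat) (c : 'I_k -> R) (s : 'I_k -> V),
     [/\ forall i, S (s i), forall i, 0 <= c i, \sum_i c i = 1
       & v = \sum_i c i *: s i]].

(* The case k = 0 puts the apex 0 in every cone. *)
Definition conic_hull S : set V :=
  [set v | exists (k : nat) (c : 'I_k -> R) (s : 'I_k -> V),
     [/\ forall i, S (s i), forall i, 0 <= c i
       & v = \sum_i c i *: s i]].

Definition minkowski_sum S S' : set V :=
  [set z | exists2 x, S x & exists2 y, S' y & z = x + y].

Definition is_translate S S' : Prop :=
  exists x, S = [set x + v | v in S'].

(* For nonempty S the subspace exists and is unique, see dirP; dir set0 is the
   junk value 0. *)
Definition dir S : {vspace V} :=
  xget 0%VS [set U : {vspace V} | is_translate (aff_hull S) [set` U]].

(* Interior in the subspace topology of the affine hull; since V is finite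
   dimensional, its topology is that of the sup norm of the coordinates in any
   basis, here vbasis. *)
Definition relint S : set V :=
  [set x | S x /\ exists2 e : R, 0 < e &
     forall y, aff_hull S y ->
       (forall i, `|coord (vbasis (fullv : {vspace V})) i (y - x)| < e) ->
       S y].

Definition polytope S : Prop := exists s : seq V, S = conv_hull [set` s].

(* C_x S *)
Definition local_cone S x : set V := conic_hull [set y - x | y in S].

Definition affine_hyperplane S : Prop :=
  exists U : {vspace V},
    (\dim U).+1 = \dim (fullv : {vspace V}) /\ is_translate S [set` U].

Definition Zspan (s : seq V) : set V :=
  [set v | exists c : nat -> int, v = \sum_(i < size s) s`_i *~ c i].

(* s is a basis of the free abelian group L. *)
Definition is_Zbasis (L : set V) (s : seq V) : Prop :=
  L = Zspan s /\
  forall c : nat -> int, \sum_(i < size s) s`_i *~ c i = 0 ->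
    forall i, (i < size s)%N -> c i = 0.

Lemma lin_span_vspace S : exists U : {vspace V}, [set` U] = lin_span S.
Proof.
pose Q d := `[< exists s : seq V, {in s, forall x, S x} /\ \dim <<s>> = d >].
have Q0 : exists d, Q d.
  by exists 0%N; apply/asboolP; exists [::]; rewrite span_nil dimv0.
have Qb d : Q d -> (d <= \dim (fullv : {vspace V}))%N.
  by move=> /asboolP[s [_ <-]]; apply/dimvS/subvf.
case: (ex_maxnP Q0 Qb) => d /asboolP[s [sS sd]] dmax.
have Ss x : S x -> x \in <<s>>%VS.
  move=> Sx; have /dmax : Q (\dim <<x :: s>>).
    apply/asboolP; exists (x :: s); split=> // y.
    by rewrite inE => /orP[/eqP->|/sS].
  rewrite -sd span_cons => le.
  have /eqP-> : <<s>>%VS == (<[x]> + <<s>>)%VS by rewrite eqEdim addvSr.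
  by rewrite (subvP (addvSl _ _)) // memv_line.
exists <<s>>%VS; apply/seteqP; split=> v /=.
  move=> vs; exists (size s), (fun i => coord (in_tuple s) i v), (fun i => s`_i).
  by split; [move=> i; apply/sS/mem_nth | exact: (@coord_span _ _ _ (in_tuple s))].
move=> [k [c [t [tS ->]]]]; apply: memv_suml => i _.
by apply/memvZ/Ss.
Qed.

Lemma dirP S : S !=set0 -> is_translate (aff_hull S) [set` dir S].
Proof.
move=> [x0 Sx0]; apply: (@xgetPex _ 0%VS
  [set U : {vspace V} | is_translate (aff_hull S) [set` U]]).
have [U UE] := lin_span_vspace [set y - x0 | y in S].
exists U, x0; rewrite UE; apply/seteqP; split=> v /=.
  move=> [k [c [s [sS c1 ->]]]]; exists (\sum_i c i *: (s i - x0)).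
    by exists k, c, (fun i => s i - x0); split=> // i; exists (s i).
  under eq_bigr do rewrite scalerBr.
  by rewrite sumrB -scaler_suml c1 scale1r addrC subrK.
move=> [w [k [c [s [sS ->]]]] <-].
exists k.+1, (fun i => oapp c (1 - \sum_i c i) (unlift ord0 i)),
  (fun i => oapp (fun j => s j + x0) x0 (unlift ord0 i)); split.
- by move=> i; case: unliftP => [j|] _ //=; case: (sS j) => y Sy <-; rewrite subrK.
- rewrite big_ord_recl unlift_none /=.
  by rewrite [X in _ + X](eq_bigr c) ?subrK // => i _; rewrite liftK.
- rewrite big_ord_recl unlift_none /=.
  rewrite [X in _ = _ + X](eq_bigr (fun i => c i *: s i + c i *: x0));
    last first.
    by move=> i _; rewrite liftK /= scalerDr.
  rewrite big_split /= -scaler_suml scalerBl scale1r.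
  by rewrite [X in _ = _ + X]addrC addrA subrK.
Qed.

End Hulls.

(* exp : g -> G is the exponential map of an n-dimensional torus, written
   additively: a homomorphism from g onto G whose kernel is a full-rank lattice,
   i.e. the Z-span of an R-basis of g. Thus dim g = n and G = g / ker exp. *)
Definition torus_exp {R : realType} (n : nat) (g : vectType R) (G : zmodType)
    (exp : {additive g -> G}) : Prop :=
  (forall a : G, exists x : g, exp x = a) /\
  (exists2 b : n.-tuple g, basis_of fullv b &
     [set x | exp x = 0] = Zspan b).

Section Polytopes.
Context {R : realType} {g : vectType R} {G : zmodType}.
Variable exp : {additive g -> G}.

Notation dual := 'Hom(g, R^o).
Implicit Types (P F A : set dual) (xi eta : dual).

Definition integral_lattice : set g := [set v | exp v = 0].

Definition weight_lattice : set dual :=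
  [set xi | forall v, integral_lattice v -> (xi v : R) \is a Num.int].

(* Faces are nonempty by convention, so that the empty set is never a facet of
   a segment; v = 0 gives P itself. *)
Definition is_face P F : Prop :=
  F !=set0 /\ exists (v : g) (c : R),
    (forall xi, P xi -> c <= xi v) /\ F = [set xi | P xi /\ xi v = c].

Definition Vert P : set dual := [set xi | is_face P [set xi]].

Definition is_facet P F : Prop :=
  is_face P F /\ (\dim (dir F)).+1 = \dim (dir P).

(* L_xi P: the face containing xi in its relative interior is unique. *)
Definition tangent_span P xi : set dual :=
  [set z | exists F, [/\ is_face P F, relint F xi
                       & lin_span [set eta - xi | eta in F] z]].

Definition rational_polytope P : Prop :=
  polytope P /\
  exists s : seq (g * R),
    (forall h, h \in s -> integral_lattice h.1) /\
    P = [set xi | forall h, h \in s -> h.2 <= xi h.1].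

Definition unimodular P : Prop :=
  rational_polytope P /\
  forall xi, Vert P xi ->
    exists2 e : seq dual, is_Zbasis (weight_lattice `&` [set` dir P]) e
                        & local_cone P xi = conic_hull [set` e].

(* For n-dimensional polytopes; e lists the common elements e_1, ..., e_(n-1)
   of the two bases. *)
Definition mergeable Dp Dm F : Prop :=
  forall eta, Vert F eta ->
    exists (e : seq dual) (ep em : dual),
      [/\ is_Zbasis weight_lattice (rcons e ep) /\
            local_cone Dp eta = conic_hull [set` rcons e ep],
          is_Zbasis weight_lattice (rcons e em) /\
            local_cone Dm eta = conic_hull [set` rcons e em],
          local_cone F eta = conic_hull [set` e]
        & em = - ep].

Definition rational_subspace (B : {vspace dual}) : Prop :=
  lin_span ([set` B] `&` weight_lattice) = [set` B].

Definition int_transverse A P : Prop :=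
  exists B : {vspace dual},
    [/\ rational_subspace B, is_translate A [set` B], rational_polytope P
      & forall xi, (A `&` P) xi ->
          minkowski_sum ([set` B] `&` weight_lattice)
                        (tangent_span P xi `&` weight_lattice) =
          minkowski_sum ([set` B] `&` weight_lattice)
                        ([set` dir P] `&` weight_lattice)].

End Polytopes.

(* Main.v *)
(* Let H be the hyperplane of F, and at a vertex eta of F let e be the common
   basis vectors and f, -f the two remaining ones. Mergeability puts Dp and Dm
   on opposite sides of H. If a segment from Dp to Dm crossed H at z outside F,
   some inequality of Dp would fail at z; choose the vertex eta of F that
   minimises it. The end points lie in eta + cone(e, f) and eta + cone(e, -f),
   so z lies in eta + cone(e), which is the local cone of F, and there the
   inequality holds: contradiction. Hence the union is convex, and every segment
   from a point of Dp off H to a point of Dm leaves Dp through F; therefore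
   vertices, local cones and active inequalities of Dp at points off H are also
   those of the union. The points eta + t f and eta - t f of the union show that
   eta is not a vertex of it. For transversality at xi, the smallest face of the
   union containing xi contains a vertex eta of F, hence also eta + t f for small
   t of either sign, so that f lies in its span. *)
Require Import Defs.
From mathcomp Require Import all_boot all_order all_algebra.
From mathcomp Require Import boolp classical_sets reals.
From mathcomp Require Import ring lra.
Import Order.TTheory GRing.Theory Num.Theory.
Local Open Scope classical_set_scope.
Local Open Scope ring_scope.

Set Implicit Arguments.
Unset Strict Implicit.
Unset Printing Implicit Defensive.

(** * Finite minima and small perturbations *)

Lemma seq_argmin {R : realType} (T : eqType) (f : T -> R) (s : seq T) :
  s <> [::] -> exists2 x, x \in s & forall y, y \in s -> f x <= f y.
Proof.
elim: s => [//|a [|b s] IH _].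
  by exists a; rewrite ?mem_head // => y; rewrite inE => /eqP->.
have [//|x xs xmin] := IH.
have [le|lt] := leP (f a) (f x).
  exists a; first exact: mem_head.
  move=> y; rewrite inE => /orP[/eqP-> //|ys].
  exact: le_trans le (xmin _ ys).
exists x; first by rewrite inE xs orbT.
by move=> y; rewrite inE => /orP[/eqP->|/xmin //]; apply: ltW.
Qed.

(** Positivity survives shrinking the factor, so the minimum of the bounds for the single pairs
    works. For [(a, b)] the choice [d = a / (|b| + 1)] gives [d * (|b| + 1 + b)]. *)
Lemma seq_perturbation {R : realType} (l : seq (R * R)) :
  (forall p, p \in l -> 0 < p.1) ->
  exists2 e : R, 0 < e & forall p, p \in l -> 0 < p.1 + e * p.2.
Proof.
elim: l => [|[a b] l IH] lpos; first by exists 1.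
have [|e e0 le] := IH; first by move=> p pl; apply: lpos; rewrite inE pl orbT.
have a0 : 0 < a by apply: (lpos (a, b)); rewrite mem_head.
pose d := a / (`|b| + 1).
have b1 : 0 < `|b| + 1 by rewrite ltr_wpDl.
have d0 : 0 < d by rewrite divr_gt0.
have shrink (u x y : R) : 0 < u -> 0 < x -> 0 < x + u * y ->
    forall m, 0 < m <= u -> 0 < x + m * y.
  by move=> u0 x0 xy m /andP[m0 mu]; case: (lerP 0 y) => y0; nra.
have ab : 0 < a + d * b.
  have -> : a + d * b = d * (`|b| + 1 + b).
    by rewrite mulrDr /d mulfVK // gt_eqF.
  rewrite mulr_gt0 //.
  by have := ler_norm (- b); rewrite normrN; lra.
exists (Num.min d e); first by rewrite lt_min d0.
have m0 : 0 < Num.min d e by rewrite lt_min d0.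
move=> p; rewrite inE => /orP[/eqP->|pl] /=.
  by apply: (shrink d) => //; rewrite m0 ge_min lexx.
apply: (shrink e); rewrite ?m0 ?ge_min ?lexx ?orbT //; last exact: le.
by apply: lpos; rewrite inE pl orbT.
Qed.

(** * Convex hulls, local cones and affine hulls *)

Section Hulls.
Context {R : realType} {V : vectType R}.
Implicit Types (S : set V) (U : {vspace V}) (x y v : V).

Definition convex_set S := forall x y (t : R),
  S x -> S y -> 0 <= t <= 1 -> S (t *: x + (1 - t) *: y).

(** Induction on the number of points: the tail, divided by [1 - c ord0], is again a convex
    combination; if that factor is 0, the tail has no weight. *)
Lemma convex_set_sum S k (c : 'I_k -> R) (s : 'I_k -> V) : convex_set S ->
  (forall i, S (s i)) -> (forall i, 0 <= c i) -> \sum_i c i = 1 ->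
  S (\sum_i c i *: s i).
Proof.
move=> Sconv; elim: k c s => [|k IH] c s sS c0 c1.
  by move: c1; rewrite big_ord0 => /esym/eqP; rewrite oner_eq0.
move: c1; rewrite !big_ord_recl => c1.
have r0 : 0 <= \sum_(i < k) c (lift ord0 i) by apply: sumr_ge0.
have [c01|c01] := eqVneq (c ord0) 1.
  have /eqP : \sum_(i < k) c (lift ord0 i) = 0 by lra.
  rewrite psumr_eq0 // => /allP ci0.
  rewrite big1 ?addr0 ?c01 ?scale1r // => i _.
  by have /eqP-> := ci0 i (mem_index_enum _); rewrite scale0r.
have c0lt : 1 - c ord0 != 0 by rewrite subr_eq0 eq_sym.
have -> : \sum_(i < k) c (lift ord0 i) *: s (lift ord0 i) = (1 - c ord0) *:
    \sum_(i < k) (c (lift ord0 i) / (1 - c ord0)) *: s (lift ord0 i).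
  rewrite scaler_sumr; apply: eq_bigr => i _.
  by rewrite scalerA mulrCA divff // mulr1.
apply: Sconv => //; last by rewrite c0 /=; lra.
apply: IH => //.
  by move=> i; rewrite divr_ge0 //; lra.
rewrite -mulr_suml -[X in X / _](addKr (c ord0)) c1 addrC divff //.
Qed.

Lemma conv_hull_min S T : convex_set T -> S `<=` T -> conv_hull S `<=` T.
Proof.
move=> Tconv ST _ [k [c [s [sS c0 c1 ->]]]].
by apply: convex_set_sum => // i; apply: ST.
Qed.

Lemma sub_conv_hull S : S `<=` conv_hull S.
Proof.
move=> x Sx; exists 1%N, (fun=> 1), (fun=> x).
by split=> //; rewrite big_ord1 ?scale1r.
Qed.

(** Concatenation of two families, used to add two combinations. *)
Definition sum_fun (k k' : nat) (T : Type) (a : 'I_k -> T) (b : 'I_k' -> T)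
  (i : 'I_(k + k')) : T :=
  match split i with inl j => a j | inr j => b j end.

Lemma sum_funP (k k' : nat) (T : Type) (a : 'I_k -> T) (b : 'I_k' -> T)
    (P : T -> Prop) :
  (forall i, P (a i)) -> (forall i, P (b i)) -> forall i, P (sum_fun a b i).
Proof. by move=> Pa Pb i; rewrite /sum_fun; case: split. Qed.

Lemma sum_fun_scale (k k' : nat) (a : 'I_k -> R) (b : 'I_k' -> R)
    (s : 'I_k -> V) (s' : 'I_k' -> V) :
  \sum_i sum_fun a b i *: sum_fun s s' i
  = \sum_i a i *: s i + \sum_i b i *: s' i.
Proof.
rewrite big_split_ord; congr (_ + _); apply: eq_bigr => i _; rewrite /sum_fun.
  by rewrite -[lshift _ _]/(unsplit (inl i)) unsplitK.
by rewrite -[rshift _ _]/(unsplit (inr i)) unsplitK.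
Qed.

Lemma sum_fun_sum (k k' : nat) (a : 'I_k -> R) (b : 'I_k' -> R) :
  \sum_i sum_fun a b i = \sum_i a i + \sum_i b i.
Proof.
rewrite big_split_ord; congr (_ + _); apply: eq_bigr => i _; rewrite /sum_fun.
  by rewrite -[lshift _ _]/(unsplit (inl i)) unsplitK.
by rewrite -[rshift _ _]/(unsplit (inr i)) unsplitK.
Qed.

Lemma convex_conv_hull S : convex_set (conv_hull S).
Proof.
move=> _ _ t [k [c [s [sS c0 c1 ->]]]] [k' [c' [s' [sS' c0' c1' ->]]]].
move=> /andP[t0 t1].
exists (k + k')%N, (sum_fun (fun i => t * c i) (fun i => (1 - t) * c' i)),
  (sum_fun s s'); split.
- exact: sum_funP.
- by apply: (sum_funP (P := fun r => 0 <= r)) => i; rewrite mulr_ge0 // subr_ge0.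
- by rewrite sum_fun_sum -!mulr_sumr c1 c1' !mulr1 addrC subrK.
- rewrite sum_fun_scale !scaler_sumr.
  by congr (_ + _); apply: eq_bigr => i _; rewrite scalerA.
Qed.

Lemma conic_hull_min S (T : set V) : T 0 ->
  (forall x y, T x -> T y -> T (x + y)) ->
  (forall x (a : R), 0 <= a -> T x -> T (a *: x)) ->
  S `<=` T -> conic_hull S `<=` T.
Proof.
move=> T0 TD TZ ST _ [k [c [s [sS c0 ->]]]].
by apply: big_ind => // i _; apply/TZ/ST.
Qed.

Lemma sub_conic_hull S : S `<=` conic_hull S.
Proof.
move=> x Sx; exists 1%N, (fun=> 1), (fun=> x).
by split=> //; rewrite big_ord1 ?scale1r.
Qed.

Lemma conic_hull0 S : conic_hull S 0.
Proof.
exists 0%N, (fun=> 0), (fun=> 0); split=> // [[//]|].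
by rewrite big_ord0.
Qed.

Lemma conic_hullD S x y : conic_hull S x -> conic_hull S y -> conic_hull S (x + y).
Proof.
move=> [k [c [s [sS c0 ->]]]] [k' [c' [s' [sS' c0' ->]]]].
exists (k + k')%N, (sum_fun c c'), (sum_fun s s'); split.
- exact: sum_funP.
- exact: (sum_funP (P := fun r => 0 <= r)).
- by rewrite sum_fun_scale.
Qed.

Lemma conic_hullZ S x (a : R) : 0 <= a -> conic_hull S x -> conic_hull S (a *: x).
Proof.
move=> a0 [k [c [s [sS c0 ->]]]]; exists k, (fun i => a * c i), s; split=> //.
  by move=> i; rewrite mulr_ge0.
by rewrite scaler_sumr; apply: eq_bigr => i _; rewrite scalerA.
Qed.

Lemma conic_hull_sub S T : S `<=` conic_hull T -> conic_hull S `<=` conic_hull T.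
Proof.
move=> ST; apply: conic_hull_min => //.
- exact: conic_hull0.
- by move=> x y; apply: conic_hullD.
- by move=> x a; apply: conic_hullZ.
Qed.

Lemma conic_hull_vspace S U : S `<=` [set` U] -> conic_hull S `<=` [set` U].
Proof.
move=> SU; apply: conic_hull_min => //=; first exact: mem0v.
  by move=> x y; apply: memvD.
by move=> x a _; apply: memvZ.
Qed.

Lemma conic_hull_rcons (s : seq V) (y z : V) :
  conic_hull [set` rcons s y] z ->
  exists2 x, conic_hull [set` s] x & exists2 a : R, 0 <= a & z = x + a *: y.
Proof.
move: z; apply: conic_hull_min.
- by exists 0; [exact: conic_hull0|exists 0; rewrite // scale0r addr0].
- move=> _ _ [x xs [a a0 ->]] [x' xs' [a' a0' ->]].
  exists (x + x'); first exact: conic_hullD.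
  exists (a + a'); first exact: addr_ge0.
  by rewrite scalerDl addrACA.
- move=> _ b b0 [x xs [a a0 ->]]; exists (b *: x); first exact: conic_hullZ.
  by exists (b * a); rewrite ?mulr_ge0 // scalerDr scalerA.
- move=> z /=; rewrite mem_rcons inE => /orP[/eqP->|zs].
    by exists 0; [exact: conic_hull0|exists 1; rewrite // scale1r add0r].
  exists z; first exact: sub_conic_hull.
  by exists 0; rewrite // scale0r addr0.
Qed.

Lemma mem_local_cone S x y : S y -> local_cone S x (y - x).
Proof. by move=> Sy; apply: sub_conic_hull; exists y. Qed.

(** The [z] with this property form a convex cone containing every [y - x]. For a sum, the step
    [t * u / (t + u)] makes the new point a convex combination of the two known ones. *)
Lemma local_cone_near S x z : convex_set S -> S x -> local_cone S x z ->
  exists2 t : R, 0 < t & S (x + t *: z).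
Proof.
move=> Sc Sx; move: z; apply: conic_hull_min.
- by exists 1; rewrite // scaler0 addr0.
- move=> y z [t t0 St] [u u0 Su].
  have tu0 : 0 < t + u by rewrite addr_gt0.
  exists (t * u / (t + u)); first by rewrite divr_gt0 // mulr_gt0.
  have -> : x + (t * u / (t + u)) *: (y + z) =
      (u / (t + u)) *: (x + t *: y) + (1 - u / (t + u)) *: (x + u *: z).
    have -> : 1 - u / (t + u) = t / (t + u) by field; rewrite gt_eqF.
    rewrite !scalerDr !scalerA addrACA -scalerDl -mulrDl [u + t]addrC.
    rewrite divff ?gt_eqF // scale1r.
    by rewrite [u / _ * t]mulrC mulrA [t / _ * u]mulrAC.
  apply: Sc => //; rewrite divr_ge0 ?ler_pdivrMr //; lra.
- move=> y a; rewrite le_eqVlt => /orP[/eqP<- _|a0 [t t0 St]].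
    by exists 1; rewrite // scale0r scaler0 addr0.
  exists (t / a); first exact: divr_gt0.
  by rewrite scalerA mulfVK // gt_eqF.
- by move=> _ [y Sy <-]; exists 1; rewrite // scale1r addrC subrK.
Qed.

(** As [dir] is picked by [xget], this is its working description: any point of [S] may serve as
    base point. *)
Lemma aff_hullE S x y : S x -> aff_hull S y <-> y - x \in dir S.
Proof.
move=> Sx; have [|a aE] := @dirP _ _ S; first by exists x.
have [u uS xE] : [set a + v | v in [set` dir S]] x.
  rewrite -aE; exists 1%N, (fun=> 1), (fun=> x).
  by split=> //; rewrite big_ord1 ?scale1r.
rewrite aE; split=> [[w wS <-]|yx].
  by rewrite -xE opprD addrACA subrr add0r memvB.
exists (y - x + u); first exact: memvD.
by rewrite addrC -addrA [u + a]addrC xE subrK.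
Qed.

Lemma mem_dir S x y : S x -> S y -> y - x \in dir S.
Proof.
move=> Sx Sy; apply/aff_hullE => //.
exists 1%N, (fun=> 1), (fun=> y).
by split=> //; rewrite big_ord1 ?scale1r.
Qed.

Lemma aff_hull_min S U x y : (forall z, S z -> z - x \in U) ->
  aff_hull S y -> y - x \in U.
Proof.
move=> SU [k [c [s [sS c1 ->]]]].
rewrite -[x]scale1r -c1 scaler_suml -sumrB; apply: memv_suml => i _.
by rewrite -scalerBr memvZ // SU.
Qed.

Lemma dir_min S U x : S x -> (forall y, S y -> y - x \in U) -> (dir S <= U)%VS.
Proof.
move=> Sx SU; apply/subvP => v vS; rewrite -(addrK x v).
apply: (aff_hull_min SU); apply/(aff_hullE _ Sx).
by rewrite addrK.
Qed.

Lemma dir_mono S T : S !=set0 -> S `<=` T -> (dir S <= dir T)%VS.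
Proof.
move=> [x Sx] ST; apply: (dir_min Sx) => y Sy.
by apply: mem_dir; apply: ST.
Qed.

Lemma lin_span_sub S U : S `<=` [set` U] -> lin_span S `<=` [set` U].
Proof.
move=> SU _ [k [c [s [sS ->]]]]; apply: memv_suml => i _; apply: memvZ.
exact: SU.
Qed.

Lemma sub_lin_span S : S `<=` lin_span S.
Proof.
move=> x Sx; exists 1%N, (fun=> 1), (fun=> x).
by split=> //; rewrite big_ord1 ?scale1r.
Qed.

End Hulls.

(** * Faces and vertices of polytopes in the dual space *)

Section Dual.
Context {R : realType} {g : vectType R}.
Notation dual := 'Hom(g, R^o).
Implicit Types (P Q S : set dual) (x y z xi eta : dual) (v w : g) (c : R).

(* The value [x v] seen in [R] rather than in [R^o]. *)
Definition pr x v : R := x v.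

Lemma prD x y v : pr (x + y) v = pr x v + pr y v.
Proof. by rewrite /pr add_lfunE. Qed.

Lemma prN x v : pr (- x) v = - pr x v.
Proof. by rewrite /pr opp_lfunE. Qed.

Lemma prB x y v : pr (x - y) v = pr x v - pr y v.
Proof. by rewrite prD prN. Qed.

Lemma prZ (a : R) x v : pr (a *: x) v = a * pr x v.
Proof. by rewrite /pr scale_lfunE. Qed.

Lemma pr0 v : pr 0 v = 0.
Proof. by rewrite /pr zero_lfunE. Qed.

Lemma pr_sum I (r : seq I) (p : pred I) (F : I -> dual) v :
  pr (\sum_(i <- r | p i) F i) v = \sum_(i <- r | p i) pr (F i) v.
Proof. by rewrite /pr sum_lfunE. Qed.

Lemma prDr x v w : pr x (v + w) = pr x v + pr x w.
Proof. by rewrite /pr linearD. Qed.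

Lemma prNr x v : pr x (- v) = - pr x v.
Proof. by rewrite /pr linearN. Qed.

Lemma prZr (a : R) x v : pr x (a *: v) = a * pr x v.
Proof. by rewrite /pr linearZ. Qed.

Lemma pr_sumr I (r : seq I) (p : pred I) (F : I -> g) x :
  pr x (\sum_(i <- r | p i) F i) = \sum_(i <- r | p i) pr x (F i).
Proof. by rewrite /pr linear_sum. Qed.

Lemma pr_separation x y : x != y -> exists v, pr x v != pr y v.
Proof. by move=> /lfunPn. Qed.

Lemma VertP P eta : Vert P eta <->
  P eta /\ exists v, forall x, P x -> x <> eta -> pr eta v < pr x v.
Proof.
split=> [[_ [v [c [Pc /seteqP[etaP Peta]]]]]|[Peta [v vmin]]].
  have [Pe ec] := etaP eta erefl; split=> //; exists v => x Px xe.
  rewrite /pr ec lt_neqAle [_ <= _]Pc // andbT eq_sym.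
  by apply/eqP => xc; apply: xe; apply: Peta.
split; first by exists eta.
exists v, (pr eta v); split.
  move=> x Px; have [->//|/eqP xe] := eqVneq x eta.
  exact: ltW (vmin _ Px xe).
apply/seteqP; split=> [_ ->//|x [Px xE]] /=.
apply: contrapT => xe; have := vmin _ Px xe.
by rewrite {2}/pr xE ltxx.
Qed.

Lemma Vert_sub P Q eta : P `<=` Q -> P eta -> Vert Q eta -> Vert P eta.
Proof.
move=> PQ Pe /VertP[_ [v vmin]]; apply/VertP; split=> //.
by exists v => x /PQ; apply: vmin.
Qed.

Lemma convex_halfspace v c : convex_set [set x | c <= pr x v].
Proof. by move=> x y t /= cx cy /andP[t0 t1]; rewrite prD !prZ; nra. Qed.

Lemma convex_hyperplane v c : convex_set [set x | pr x v = c].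
Proof. by move=> x y t /= cx cy _; rewrite prD !prZ cx cy; ring. Qed.

Lemma local_cone_ge P eta w z : (forall x, P x -> pr eta w <= pr x w) ->
  local_cone P eta z -> 0 <= pr z w.
Proof.
move=> Pw; move: z; apply: conic_hull_min => /=.
- by rewrite pr0.
- by move=> x y x0 y0; rewrite prD addr_ge0.
- by move=> x a a0 x0; rewrite prZ mulr_ge0.
- by move=> _ [y Py <-]; rewrite /= prB subr_ge0 Pw.
Qed.

(** At the value [c] the nonnegative terms [a i * (pr (t i) v - c)] sum to 0, so only generators on
    the face carry weight. *)
Lemma conv_hull_face (s : seq dual) v c :
  (forall x, x \in s -> c <= pr x v) ->
  conv_hull [set` s] `&` [set x | pr x v = c] =
  conv_hull [set` [seq x <- s | pr x v == c]].
Proof.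
move=> sc; apply/seteqP; split; last first.
  apply: conv_hull_min.
    move=> x y t [xs xc] [ys yc] t01; split; first exact: convex_conv_hull.
    exact: convex_hyperplane.
  move=> x /=; rewrite mem_filter => /andP[/eqP xc xs]; split=> //.
  exact: sub_conv_hull.
move=> x [[k [a [t [ts a0 a1 xE]]]] /= xc].
have {}ts i : t i \in s by apply: ts.
have ac0 i : a i * (pr (t i) v - c) = 0.
  have /eqP : \sum_i a i * (pr (t i) v - c) = 0.
    under eq_bigr do rewrite mulrBr -prZ.
    by rewrite sumrB -pr_sum -xE xc -mulr_suml a1 mul1r subrr.
  rewrite psumr_eq0 => [/allP /(_ i (mem_index_enum _)) /eqP //|j _].
  by rewrite mulr_ge0 // subr_ge0 sc.
have face i : a i != 0 -> t i \in [seq x <- s | pr x v == c].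
  move=> ai; rewrite mem_filter ts andbT.
  by move/eqP: (ac0 i); rewrite mulf_eq0 (negPf ai) subr_eq0.
have [i0 ai0] : exists i, a i != 0.
  apply: contrapT => na; move: a1; rewrite big1 => [/esym/eqP|i _].
    by rewrite oner_eq0.
  by apply/eqP; apply: contrapT => /negP ai; apply: na; exists i.
(* Points of weight zero may lie off the face; they are replaced by one of nonzero weight, which is
   on it. *)
exists k, a, (fun i => if a i == 0 then t i0 else t i); split=> //.
  by move=> i /=; case: ifPn => [_|]; apply: face.
rewrite xE; apply: eq_bigr => i _; case: ifPn => // /eqP->.
by rewrite !scale0r.
Qed.

(* If a functional has several minimisers, adding a small multiple of one that
   separates two of them keeps the minimisers among the old ones but loses at
   least one. *)
Lemma seq_exposed_min (s : seq dual) w : s <> [::] ->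
  exists eta w', [/\ eta \in s, forall x, x \in s -> pr eta w <= pr x w
    & forall x, x \in s -> x <> eta -> pr eta w' < pr x w'].
Proof.
(* [undup] makes the size of [T w] count distinct minimisers, so that losing one shrinks it. *)
move=> s0; pose T w := [seq x <- undup s | all (fun y => pr x w <= pr y w) s].
have memT w1 x : x \in T w1 ->
    x \in s /\ forall y, y \in s -> pr x w1 <= pr y w1.
  by rewrite mem_filter mem_undup => /andP[/allP].
have inT w1 x : x \in s -> (forall y, y \in s -> pr x w1 <= pr y w1) -> x \in T w1.
  by move=> xs xmin; rewrite mem_filter mem_undup xs andbT; apply/allP.
have T0 w1 : exists x, x \in T w1.
  by have [x xs xmin] := seq_argmin (fun x => pr x w1) s0; exists x; apply: inT.
suff main k : forall w, (size (T w) <= k)%N ->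
    exists eta w', [/\ eta \in T w
      & forall x, x \in s -> x <> eta -> pr eta w' < pr x w'].
  have [eta [w' [/memT[es emin] eu]]] := main _ w (leqnn _).
  by exists eta, w'.
elim: k => [|k IH] {}w.
  by have [x] := T0 w; case: (T w).
move=> szT; have [x0 x0T] := T0 w.
have [single|] := pselect (forall x, x \in T w -> x = x0).
  exists x0, w; split=> // x xs xx0; have [_ x0min] := memT _ _ x0T.
  rewrite ltNge; apply/negP => le; apply: xx0; apply: single.
  by apply: inT => // y ys; apply: le_trans le (x0min _ ys).
move=> /existsNP[x1 /not_implyP[x1T /eqP /pr_separation[u x1u]]].
have [x [y [xT yT xyu]]] : exists x y, [/\ x \in T w, y \in T w & pr x u < pr y u].
  by case: (ltgtP (pr x1 u) (pr x0 u)) x1u => // ? _; [exists x1, x0|exists x0, x1].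
have [[xs xmin] [ys ymin]] := (memT _ _ xT, memT _ _ yT).
(* The pairs record by how much each non-minimiser exceeds [x] under [w] and under [u]; a positive
   combined gap keeps it from becoming a minimiser. *)
pose l := [seq (pr z w - pr x w, pr z u - pr x u) | z <- s & pr x w < pr z w].
have [p|e e0 le] := @seq_perturbation _ l.
  by move=> /mapP[z]; rewrite mem_filter => /andP[lt _] -> /=; rewrite subr_gt0.
have Tsub z : z \in T (w + e *: u) -> z \in T w.
  move=> /memT[zs zmin]; apply: inT => // z' z's.
  apply: le_trans (xmin _ z's); rewrite leNgt; apply/negP => lt.
  have zl : (pr z w - pr x w, pr z u - pr x u) \in l.
    apply: (map_f (fun z => (pr z w - pr x w, pr z u - pr x u))).
    by rewrite mem_filter lt.
  have /= := le _ zl; have := zmin _ xs; rewrite !prDr !prZr; lra.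
have yT' : y \notin T (w + e *: u).
  apply/negP => /memT[_ /(_ _ xs)]; rewrite !prDr !prZr.
  by have := ymin _ xs; have := xmin _ ys; nra.
have [|eta [w' [eT eu]]] := IH (w + e *: u); last first.
  by exists eta, w'; split=> //; apply: Tsub.
rewrite -ltnS; apply: leq_trans szT.
apply: (@uniq_leq_size _ (y :: T (w + e *: u))).
  by rewrite /= yT' filter_uniq // undup_uniq.
by move=> z; rewrite inE => /orP[/eqP-> //|]; apply: Tsub.
Qed.

(** Some minimiser of [w] among the generators is the strict minimiser of another functional [w'];
    the face of the hull cut out by [w'] is then generated by [eta] alone. *)
Lemma conv_hull_vertex (s : seq dual) w : conv_hull [set` s] !=set0 ->
  exists2 eta, Vert (conv_hull [set` s]) eta
    & forall x, conv_hull [set` s] x -> pr eta w <= pr x w.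
Proof.
move=> [x0 x0s].
have [|eta [w' [es emin eu]]] := @seq_exposed_min s w.
  move=> s0; case: x0s; rewrite s0 => -[|k] [c [t [ts _ c1 _]]].
    by move: c1; rewrite big_ord0 => /esym/eqP; rewrite oner_eq0.
  by have := ts ord0.
exists eta; last exact: (conv_hull_min (@convex_halfspace w _)).
apply/VertP; split; first exact: sub_conv_hull.
have ge x : x \in s -> pr eta w' <= pr x w'.
  by move=> xs; have [->//|/eqP xe] := eqVneq x eta; apply/ltW/eu.
exists w' => x xs xe.
rewrite lt_neqAle [_ <= _](conv_hull_min (@convex_halfspace w' _) ge xs) andbT.
apply/eqP => xE; apply: xe.
have : (conv_hull [set` s] `&` [set x | pr x w' = pr eta w']) x by [].
rewrite (conv_hull_face ge).
apply: (conv_hull_min (T := [set eta])) => [_ _ t -> -> _|] /=.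
  by rewrite -scalerDl addrC subrK scale1r.
move=> y /=; rewrite mem_filter => /andP[/eqP ye ys].
by apply: contrapT => /(eu _ ys); rewrite ye ltxx.
Qed.

Lemma polytope_convex P : polytope P -> convex_set P.
Proof. by move=> [s ->]; apply: convex_conv_hull. Qed.

Lemma polytope_face P v c : polytope P -> (forall x, P x -> c <= pr x v) ->
  polytope (P `&` [set x | pr x v = c]).
Proof.
move=> [s ->] Pc; exists [seq x <- s | pr x v == c]; apply: conv_hull_face.
by move=> x xs; apply/Pc/sub_conv_hull.
Qed.

Lemma polytope_vertex P w : polytope P -> P !=set0 ->
  exists2 eta, Vert P eta & forall x, P x -> pr eta w <= pr x w.
Proof. by move=> [s ->]; apply: conv_hull_vertex. Qed.

Lemma exit_point (hs : seq (g * R)) x xi :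
  (forall h, h \in hs -> h.2 <= pr x h.1) ->
  ~ (forall h, h \in hs -> h.2 <= pr xi h.1) ->
  exists t h, [/\ 0 <= t < 1,
    forall h', h' \in hs -> h'.2 <= pr (t *: xi + (1 - t) *: x) h'.1,
    h \in hs, pr (t *: xi + (1 - t) *: x) h.1 = h.2 & pr xi h.1 < h.2].
Proof.
move=> hx nhxi.
(* [f h] is the parameter at which the segment from [x] to [xi] reaches the hyperplane of [h]; the
   smallest value over the inequalities violated at [xi] is the exit time. *)
pose f (h : g * R) := (pr x h.1 - h.2) / (pr x h.1 - pr xi h.1).
have [e|h] := @seq_argmin R _ f [seq h <- hs | pr xi h.1 < h.2].
  apply: nhxi => h hhs; rewrite leNgt; apply/negP => lt.
  have : h \in [seq h <- hs | pr xi h.1 < h.2] by rewrite mem_filter lt.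
  by rewrite e.
rewrite mem_filter => /andP[hlt hhs] hmin.
have hxh := hx _ hhs.
have d0 : 0 < pr x h.1 - pr xi h.1 by lra.
have fd : f h * (pr x h.1 - pr xi h.1) = pr x h.1 - h.2.
  by rewrite mulfVK // gt_eqF.
have f0 : 0 <= f h by rewrite divr_ge0; lra.
have f1 : f h < 1 by rewrite ltr_pdivrMr //; lra.
exists (f h), h; split=> //; [exact/andP| |]; last first.
  by rewrite prD !prZ; lra.
move=> h' h'hs; rewrite prD !prZ; have hx' := hx _ h'hs.
have [le|lt] := leP h'.2 (pr xi h'.1); first by nra.
have : f h <= f h' by apply: hmin; rewrite mem_filter lt.
by rewrite ler_pdivlMr; lra.
Qed.

Lemma strict_neighborhood (l : seq (g * R)) xi :
  (forall h, h \in l -> h.2 < pr xi h.1) ->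
  exists2 e : R, 0 < e & forall y,
    (forall i, `|coord (vbasis (fullv : {vspace dual})) i (y - xi)| < e) ->
    forall h, h \in l -> h.2 < pr y h.1.
Proof.
move=> lt; pose b := vbasis (fullv : {vspace dual}).
(* Evaluation at [w] is at most [M w] times the sup norm of the coordinates. *)
pose M (w : g) : R := \sum_(i < \dim (fullv : {vspace dual})) `|pr b`_i w|.
have [p|e e0 le] :=
  @seq_perturbation R [seq (pr xi h.1 - h.2, - M h.1) | h <- l].
  by move=> /mapP[h hl ->] /=; rewrite subr_gt0 lt.
exists e => // y ylt h hl.
have /= := le (pr xi h.1 - h.2, - M h.1) (map_f _ hl).
have yxi : `|pr (y - xi) h.1| <= e * M h.1.
  rewrite (coord_vbasis (memvf (y - xi))) pr_sum.
  apply: le_trans (ler_norm_sum _ _ _) _; rewrite mulr_sumr.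
  apply: ler_sum => i _; rewrite prZ normrM ler_wpM2r //.
  exact/ltW/ylt.
have := ler_norm (- pr (y - xi) h.1); rewrite normrN.
by move: yxi; rewrite prB; lra.
Qed.

Lemma aff_hull_eq S v c y : (forall x, S x -> pr x v = c) ->
  aff_hull S y -> pr y v = c.
Proof.
move=> Sc [k [a [s [sS a1 ->]]]]; rewrite pr_sum.
under eq_bigr do rewrite prZ Sc //.
by rewrite -mulr_suml a1 mul1r.
Qed.

(** Take for [w] the sum of the normals active at [xi]. On its minimal face, hence on the affine
    hull of that face, every active inequality is an equality, while the inactive ones are strict at
    [xi] and persist nearby. *)
Lemma hrep_relint_face (hs : seq (g * R)) P xi :
  P = [set x | forall h, h \in hs -> h.2 <= pr x h.1] -> P xi ->
  exists w, (forall x, P x -> pr xi w <= pr x w) /\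
    relint (P `&` [set x | pr x w = pr xi w]) xi.
Proof.
move=> PE Pxi; pose act (h : g * R) := pr xi h.1 == h.2.
have hP x h : P x -> h \in hs -> h.2 <= pr x h.1 by rewrite PE => Px; apply: Px.
exists (\sum_(h <- hs | act h) h.1).
have prw : pr xi (\sum_(h <- hs | act h) h.1) = \sum_(h <- hs | act h) h.2.
  by rewrite pr_sumr; apply: eq_bigr => h /eqP.
split.
  move=> x Px; rewrite prw pr_sumr big_seq_cond [leRHS]big_seq_cond.
  by apply: ler_sum => h /andP[hhs _]; apply: hP.
split=> //.
have [h|e e0 near_xi] := @strict_neighborhood [seq h <- hs | ~~ act h] xi.
  by rewrite mem_filter lt_neqAle eq_sym => /andP[-> hhs]; apply: hP.
exists e => // y yF ynear; split=> /=; last by apply: aff_hull_eq yF => x [].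
rewrite PE => h hhs; have [ha|ha] := boolP (act h); last first.
  by apply/ltW/(near_xi y ynear); rewrite mem_filter ha.
rewrite (aff_hull_eq (c := h.2) _ yF) // => x [Px /= xw].
have /eqP : \sum_(h <- hs | act h) (pr x h.1 - h.2) = 0.
  by rewrite sumrB -prw -xw pr_sumr subrr.
rewrite big_seq_cond psumr_eq0 => [/allP /(_ _ hhs)|h' /andP[h'hs _]].
  by rewrite hhs ha subr_eq0 => /eqP.
by rewrite subr_ge0 hP.
Qed.

Lemma kernel_vspace v : exists U : {vspace dual}, forall x, x \in U <-> pr x v = 0.
Proof.
have [U UE] := lin_span_vspace [set x | pr x v = 0].
exists U => x; have -> : x \in U <-> lin_span [set x | pr x v = 0] x.
  by rewrite -UE.
split; last exact: sub_lin_span.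
move=> [k [a [s [sS ->]]]]; rewrite pr_sum big1 // => i _.
by rewrite prZ sS mulr0.
Qed.

End Dual.

(** * Convex sets glued along a common slice of a hyperplane *)

Section Glue.
Context {R : realType} {g : vectType R}.
Notation dual := 'Hom(g, R^o).
Implicit Types (P Q F : set dual) (x y z xi eta : dual) (v w : g) (c : R).

Definition separated v c P Q :=
  [/\ forall x, P x -> c <= pr x v, forall x, Q x -> pr x v <= c
    & forall x, pr x v = c -> P x <-> Q x].

(** Lets each one-sided statement about [P] be applied to [Q]. *)
Lemma separated_sym v c P Q :
  separated v c P Q -> separated (- v) (- c) Q P.
Proof.
move=> [Pc Qc PQ]; split=> x; rewrite prNr.
- by rewrite lerN2; apply: Qc.
- by rewrite lerN2; apply: Pc.
- by move=> /oppr_inj /PQ; tauto.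
Qed.

Lemma segment_crossing v c x y : pr y v <= c < pr x v ->
  exists2 t : R, 0 <= t < 1 & pr (t *: x + (1 - t) *: y) v = c.
Proof.
move=> /andP[yc cx]; have d0 : 0 < pr x v - pr y v by lra.
have tE : (c - pr y v) / (pr x v - pr y v) * (pr x v - pr y v) = c - pr y v.
  by rewrite mulfVK // gt_eqF.
exists ((c - pr y v) / (pr x v - pr y v)); last by rewrite prD !prZ; lra.
by rewrite divr_ge0 ?ltr_pdivrMr //; lra.
Qed.

(** A segment from [P] to [Q] crosses the hyperplane at a point of both sets, and each of its two
    halves stays in one convex piece. *)
Lemma union_convex v c P Q : separated v c P Q -> convex_set P -> convex_set Q ->
  (forall x y (t : R), P x -> Q y -> 0 <= t <= 1 ->
     pr (t *: x + (1 - t) *: y) v = c -> P (t *: x + (1 - t) *: y)) ->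
  convex_set (P `|` Q).
Proof.
move=> [Pc Qc PQ] cP cQ cross.
suff main x y t : P x -> Q y -> 0 <= t <= 1 -> (P `|` Q) (t *: x + (1 - t) *: y).
  move=> x y t [Px|Qx] [Py|Qy] t01.
  - by left; apply: cP.
  - exact: main.
  - by rewrite addrC -{2}(subKr 1 t); apply: main => //; lra.
  - by right; apply: cQ.
move=> Px Qy t01; have [xc|xc] := eqVneq (pr x v) c.
  by right; apply: cQ => //; apply/PQ.
have [|u u01 zc] := @segment_crossing v c x y.
  by rewrite (Qc _ Qy) lt_neqAle eq_sym xc Pc.
have u01' : 0 <= u <= 1 by lra.
have Pz := cross _ _ _ Px Qy u01' zc; have Qz := (PQ _ zc).1 Pz.
have [ut|tu] := leP u t.
  left; have u1 : 0 < 1 - u by lra.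
  have -> : t *: x + (1 - t) *: y = ((t - u) / (1 - u)) *: x +
      (1 - (t - u) / (1 - u)) *: (u *: x + (1 - u) *: y).
    have -> : 1 - (t - u) / (1 - u) = (1 - t) / (1 - u) by field; lra.
    rewrite scalerDr !scalerA addrA -scalerDl; congr (_ *: _ + _ *: _); field; lra.
  by apply: cP => //; rewrite divr_ge0 ?ler_pdivrMr //; lra.
right; have u0 : 0 < u by lra.
have -> : t *: x + (1 - t) *: y = (t / u) *: (u *: x + (1 - u) *: y) +
    (1 - t / u) *: y.
  rewrite scalerDr !scalerA -addrA -scalerDl; congr (_ *: _ + _ *: _); field; lra.
by apply: cQ => //; rewrite divr_ge0 ?ler_pdivrMr //; lra.
Qed.

(** Convexity puts the crossing point in the union, hence in the common slice. The strict bound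
    [t < 1] allows inequalities there to be carried on to [y]. *)
Lemma union_crossing v c P Q x y : separated v c P Q -> convex_set (P `|` Q) ->
  P x -> c < pr x v -> Q y ->
  exists2 t : R, 0 <= t < 1 &
    P (t *: x + (1 - t) *: y) /\ pr (t *: x + (1 - t) *: y) v = c.
Proof.
move=> [Pc Qc PQ] cPQ Px cx Qy.
have [|t t01 zc] := @segment_crossing v c x y; first by rewrite Qc.
exists t => //; split=> //.
have [|//|/PQ] := cPQ x y t (or_introl Px) (or_intror Qy); first lra.
exact.
Qed.

(** The functional exposing [eta] in [P] is larger at the crossing point towards [y], so by
    linearity also at [y]. *)
Lemma union_Vert v c P Q eta : separated v c P Q -> convex_set (P `|` Q) ->
  c < pr eta v -> Vert P eta -> Vert (P `|` Q) eta.
Proof.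
move=> sPQ cPQ ec /VertP[Pe [w wmin]]; apply/VertP; split; first by left.
exists w => y [Py|Qy] ye; first exact: wmin.
have [t t01 [Pz zc]] := union_crossing sPQ cPQ Pe ec Qy.
have : pr eta w < pr (t *: eta + (1 - t) *: y) w.
  by apply: wmin => // zE; move: ec; rewrite -zc zE ltxx.
rewrite prD !prZ; nra.
Qed.

(** Seen from [eta], a point of [Q] lies in the direction of the crossing point, which belongs to
    [P]. *)
Lemma union_local_cone v c P Q eta : separated v c P Q -> convex_set (P `|` Q) ->
  c < pr eta v -> P eta -> local_cone (P `|` Q) eta = local_cone P eta.
Proof.
move=> sPQ cPQ ec Pe; apply/seteqP; split; last first.
  by apply: conic_hull_sub => _ [y Py <-]; apply: mem_local_cone; left.
apply: conic_hull_sub => _ [y [Py|Qy] <-]; first exact: mem_local_cone.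
have [t t01 [Pz zc]] := union_crossing sPQ cPQ Pe ec Qy.
have t1 : 0 < 1 - t by lra.
have -> : y - eta = (1 - t)^-1 *: ((t *: eta + (1 - t) *: y) - eta).
  have -> : t *: eta + (1 - t) *: y - eta = (1 - t) *: (y - eta).
    by rewrite scalerBr (scalerBl 1 t eta) scale1r opprB addrA [t *: eta + _]addrC.
  by rewrite scalerA mulVf ?scale1r // gt_eqF.
apply: conic_hullZ; first by rewrite invr_ge0 ltW.
exact: mem_local_cone.
Qed.

(* [hs'] consists of the inequalities that are equalities at some point of [P]
   strictly beyond the separating hyperplane. *)
Lemma side_hrep v c P Q (hs : seq (g * R)) :
  separated v c P Q -> convex_set (P `|` Q) ->
  P = [set x | forall h, h \in hs -> h.2 <= pr x h.1] ->
  (exists2 x, P x & c < pr x v) ->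
  exists hs' : seq (g * R), [/\ {subset hs' <= hs},
    forall x h, (P `|` Q) x -> h \in hs' -> h.2 <= pr x h.1
    & forall x, c <= pr x v -> (forall h, h \in hs' -> h.2 <= pr x h.1) -> P x].
Proof.
move=> sPQ cPQ PE [x0 Px0 cx0].
have PP x : P x <-> forall h, h \in hs -> h.2 <= pr x h.1 by rewrite PE.
pose far (h : g * R) := `[< exists2 x, P x & c < pr x v /\ pr x h.1 = h.2 >].
exists [seq h <- hs | far h]; split.
- by move=> h; rewrite mem_filter => /andP[].
- move=> x h PQx; rewrite mem_filter => /andP[/asboolP[y Py [yc yh]] hhs].
  case: PQx => [/PP|Qx]; first exact.
  (* [h] is an equality at [y] and holds at the crossing point, so it holds further on at [x]. *)
  have [t t01 [/PP/(_ _ hhs)]] := union_crossing sPQ cPQ Py yc Qx.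
  rewrite prD !prZ yh; nra.
- move=> xi cxi hxi; apply: contrapT => nP.
  (* The segment from [x0] to [xi] leaves [P] where some [h] is an equality. Since [t < 1], that
     point is still strictly beyond the hyperplane, so [h] was selected and cannot fail at [xi]. *)
  have [|t [h [t01 zP hhs zh hlt]]] := exit_point ((PP x0).1 Px0) (xi := xi).
    by move=> /PP.
  suff : h.2 <= pr xi h.1 by lra.
  apply: hxi; rewrite mem_filter hhs andbT; apply/asboolP.
  exists (t *: xi + (1 - t) *: x0); first exact/PP.
  by split=> //; rewrite prD !prZ; nra.
Qed.

(** The inequalities selected on each side are valid on the union and cut out the piece on that
    side. Being among the original ones, they keep their integral normals. *)
Lemma union_hrep v c P Q (hp hq : seq (g * R)) :
  separated v c P Q -> convex_set (P `|` Q) ->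
  P = [set x | forall h, h \in hp -> h.2 <= pr x h.1] ->
  Q = [set x | forall h, h \in hq -> h.2 <= pr x h.1] ->
  (exists2 x, P x & c < pr x v) -> (exists2 x, Q x & pr x v < c) ->
  exists hs : seq (g * R), {subset hs <= hp ++ hq} /\
    P `|` Q = [set x | forall h, h \in hs -> h.2 <= pr x h.1].
Proof.
move=> sPQ cPQ PE QE farP [y Qy yc].
have [hs [hsp hsv hsP]] := side_hrep sPQ cPQ PE farP.
have [||hs' [hsq hsv' hsQ]] := side_hrep (separated_sym sPQ) _ QE.
- by rewrite setUC.
- by exists y; rewrite // prNr ltrN2.
exists (hs ++ hs'); split.
  by move=> h; rewrite !mem_cat => /orP[/hsp->|/hsq->]; rewrite ?orbT.
apply/seteqP; split=> x.
  move=> PQx h; rewrite mem_cat => /orP[|]; first exact: hsv.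
  by apply: hsv'; rewrite setUC.
move=> /= hx; have [cx|cx] := leP c (pr x v).
  by left; apply: hsP => // h hh; apply: hx; rewrite mem_cat hh.
right; apply: hsQ; first by rewrite prNr lerN2 ltW.
by move=> h hh; apply: hx; rewrite mem_cat hh orbT.
Qed.

Lemma union_polytope P Q : polytope P -> polytope Q -> convex_set (P `|` Q) ->
  polytope (P `|` Q).
Proof.
move=> [s PE] [s' QE] cPQ; exists (s ++ s'); apply/seteqP; split.
  rewrite {1}PE {1}QE => x [xs|xs]; move: x xs; apply: conv_hull_min.
  - exact: convex_conv_hull.
  - by move=> x xs; apply: sub_conv_hull; rewrite /= mem_cat [_ \in s]xs.
  - exact: convex_conv_hull.
  - by move=> x xs; apply: sub_conv_hull; rewrite /= mem_cat [_ \in s']xs orbT.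
apply: conv_hull_min => // x /=; rewrite mem_cat => /orP[xs|xs].
  by left; rewrite PE; apply: sub_conv_hull.
by right; rewrite QE; apply: sub_conv_hull.
Qed.

(** [P] is not contained in [F], by dimension, so the kernel of [v] is a proper subspace; it
    contains [dir F], which has codimension one. *)
Lemma facet_hyperplane P F : dir P = fullv -> is_facet P F ->
  exists v c, [/\ forall x, P x -> c <= pr x v,
    F = P `&` [set x | pr x v = c],
    forall x, x \in dir F <-> pr x v = 0 & exists2 x, P x & c < pr x v].
Proof.
move=> dP [[F0 [v [c [Pc FE]]]]]; rewrite dP => dF.
have [x0 Fx0] := F0; have [Px0 x0c] : P x0 /\ pr x0 v = c.
  by move: (Fx0); rewrite FE.
have farP : exists2 x, P x & c < pr x v.
  apply: contrapT => nfar; have PF : P `<=` F.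
    rewrite FE => x Px; split=> //=; apply/eqP; rewrite eq_le Pc // andbT leNgt.
    by apply/negP => cx; apply: nfar; exists x.
  have := dimvS (dir_mono (ex_intro _ _ Px0) PF).
  by rewrite dP -dF ltnn.
exists v, c; split=> //; have [U UE] := kernel_vspace v.
suff -> : dir F = U by [].
have dFU : (dir F <= U)%VS.
  apply: (dir_min Fx0) => y; rewrite {1}FE => -[_ yc]; apply/UE.
  by rewrite prB x0c (yc : pr y v = c) subrr.
apply/eqP; rewrite eqEdim dFU /= -ltnS dF.
have : (\dim U <= \dim (fullv : {vspace dual}))%N by apply/dimvS/subvf.
rewrite leq_eqVlt => /orP[/eqP dU|//].
have UT : U = fullv by apply/eqP; rewrite eqEdim subvf dU leqnn.
have [x Px cx] := farP; have : x - x0 \in U by rewrite UT memvf.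
by move=> /UE /eqP; rewrite prB x0c subr_eq0 gt_eqF.
Qed.

End Glue.

(** * Weights and the bases at a vertex of the common facet *)

Section WeightLattice.
Context {R : realType} {g : vectType R} {G : zmodType}.
Variable exp : {additive g -> G}.
Notation dual := 'Hom(g, R^o).
Notation W := (weight_lattice exp).
Implicit Types (x y : dual) (P Q F : set dual).

Lemma weight_latticeB x y : W x -> W y -> W (x - y).
Proof.
by move=> Wx Wy v gv; rewrite -/(pr _ _) prB rpredB //; [apply: Wx|apply: Wy].
Qed.

Lemma weight_latticeD x y : W x -> W y -> W (x + y).
Proof.
by move=> Wx Wy v gv; rewrite -/(pr _ _) prD rpredD //; [apply: Wx|apply: Wy].
Qed.

Lemma weight_latticeMz x (m : int) : W x -> W (x *~ m).
Proof.
move=> Wx v gv; rewrite -scaler_int -/(pr _ _) prZ rpredM //; first exact: intr_int.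
exact: Wx.
Qed.

Lemma Zspan_mem (s : seq dual) x : x \in s -> Zspan s x.
Proof.
move=> xs; exists (fun j => (j == index x s)%:Z).
have lt : (index x s < size s)%N by rewrite index_mem.
rewrite (bigD1 (Ordinal lt)) //= eqxx mulr1z nth_index // big1 ?addr0 // => i.
by rewrite -val_eqE /= => /negPf ->; rewrite mulr0z.
Qed.

Lemma dim_dual : \dim (fullv : {vspace dual}) = \dim (fullv : {vspace g}).
Proof. by rewrite !dimvf; apply: muln1. Qed.

(** [e] spans the cone of [F] and so lies in the kernel of [v]. If [f] did too, all of [P] would lie
    in the hyperplane, against the point strictly beyond it. *)
Lemma mergeable_vertex P Q F v c eta : mergeable exp P Q F -> Vert F eta ->
  (forall x, P x -> c <= pr x v) -> F = P `&` [set x | pr x v = c] ->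
  (exists2 x, P x & c < pr x v) ->
  exists (e : seq dual) (f : dual),
    [/\ W = Zspan (rcons e f),
        local_cone P eta = conic_hull [set` rcons e f],
        local_cone Q eta = conic_hull [set` rcons e (- f)],
        local_cone F eta = conic_hull [set` e]
      & (forall x, conic_hull [set` e] x -> pr x v = 0) /\ 0 < pr f v].
Proof.
move=> merge eF Pc FE [x Px cx].
have Fc y : F y -> P y /\ pr y v = c by rewrite FE.
have [e [f [em [[[We _] CP] [_ CQ] CF emE]]]] := merge _ eF; rewrite emE in CQ.
have [/Fc[Pe ec] _] := (VertP _ _).1 eF.
have e0 : forall z, conic_hull [set` e] z -> pr z v = 0.
  rewrite -CF; apply: conic_hull_min => /=.
  - exact: pr0.
  - by move=> y z y0 z0; rewrite prD y0 z0 addr0.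
  - by move=> y a _ y0; rewrite prZ y0 mulr0.
  - by move=> _ [y /Fc[_ yc] <-]; rewrite /= prB yc ec subrr.
exists e, f; split=> //; split=> //.
have f0 : 0 <= pr f v.
  apply: (@local_cone_ge _ _ P eta) => [y|]; first by rewrite ec; apply: Pc.
  by rewrite CP; apply: sub_conic_hull; rewrite /= mem_rcons mem_head.
rewrite lt_neqAle f0 andbT eq_sym; apply/eqP => fv0.
have := mem_local_cone eta Px; rewrite CP => /conic_hull_rcons[u /e0 u0 [a _]].
by move=> /(congr1 (fun z => pr z v)); rewrite prB prD prZ u0 fv0; lra.
Qed.

End WeightLattice.

(** * The union of two mergeable unimodular polytopes *)

Unset Implicit Arguments.

Theorem proposition5p10 (R : realType) (n : nat) (g : vectType R)
    (G : zmodType) (exp : {additive g -> G})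
    (torusG : torus_exp n exp)
    (Dp Dm : set 'Hom(g, R^o))
    (uDp : unimodular exp Dp) (uDm : unimodular exp Dm)
    (dimDp : \dim (dir Dp) = n) (dimDm : \dim (dir Dm) = n)
    (facetp : is_facet Dp (Dp `&` Dm)) (facetm : is_facet Dm (Dp `&` Dm))
    (merge : mergeable exp Dp Dm (Dp `&` Dm)) :
  [/\ polytope (Dp `|` Dm),
      unimodular exp (Dp `|` Dm) /\
        Vert (Dp `|` Dm) = (Vert Dp `|` Vert Dm) `\` Vert (Dp `&` Dm)
    & exists A : set 'Hom(g, R^o),
        [/\ affine_hyperplane A, Dp `&` Dm `<=` A,
            forall A', affine_hyperplane A' -> Dp `&` Dm `<=` A' -> A' = A
          & int_transverse exp A (Dp `|` Dm)]].
Proof.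
have dimn : \dim (fullv : {vspace 'Hom(g, R^o)}) = n.
  by have [_ [b bB _]] := torusG; rewrite dim_dual (size_basis bB).
have fullp : dir Dp = fullv by apply/eqP; rewrite eqEdim subvf dimDp dimn leqnn.
have fullm : dir Dm = fullv by apply/eqP; rewrite eqEdim subvf dimDm dimn leqnn.
have [[pDp [hp [hpZ DpE]]] uVp] := uDp; have [[pDm [hm [hmZ DmE]]] uVm] := uDm.
have cDp := polytope_convex pDp; have cDm := polytope_convex pDm.
pose F := Dp `&` Dm; rewrite -/F in facetp facetm merge *.
(* Each polytope supplies its own equation for the hyperplane of [F]; [affv] and [affv'] identify
   both with the affine hull of [F]. *)
have [v [c [Dpc FE dF farp]]] := facet_hyperplane fullp facetp.
have [v' [c' [Dmc' FE' dF' [ym Dmym ymc']]]] := facet_hyperplane fullm facetm.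
have [x0 Fx0] : F !=set0 by have [[]] := facetp.
have Fc x : F x -> pr x v = c by rewrite FE => -[].
have Fc' x : F x -> pr x v' = c' by rewrite FE' => -[].
have affv x : aff_hull F x <-> pr x v = c.
  rewrite (aff_hullE _ Fx0) dF prB (Fc _ Fx0); split=> [|->]; first lra.
  exact: subrr.
have affv' x : aff_hull F x <-> pr x v' = c'.
  rewrite (aff_hullE _ Fx0) dF' prB (Fc' _ Fx0); split=> [|->]; first lra.
  exact: subrr.
have pF : polytope F by rewrite FE; apply: polytope_face.
have Fvertex w := polytope_vertex w pF (ex_intro _ _ Fx0).
have mergev eta (eF : Vert F eta) := mergeable_vertex merge eF Dpc FE farp.
have VF eta : Vert F eta -> F eta by move=> /VertP[].
have Dmc x : Dm x -> pr x v <= c.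
  (* The zero functional merely picks some vertex of [F]. The cone of [Dm] there is generated by
     [e], where [v] vanishes, and [- f], where it is negative. *)
  move=> Dmx; have [eta eF _] := Fvertex 0.
  have [e [f [_ _ CQ _ [e0 f0]]]] := mergev _ eF.
  have := mem_local_cone eta Dmx; rewrite CQ => /conic_hull_rcons[u /e0 u0 [a a0]].
  move=> /(congr1 (fun z => pr z v)).
  rewrite prB prD prZ prN u0 (Fc _ (VF _ eF)); nra.
have PQ x : pr x v = c -> Dp x <-> Dm x.
  move=> xc; split=> Dx.
    by have [] : F x by rewrite FE.
  have /affv' xc' := (affv x).2 xc.
  by have [] : F x by rewrite FE'.
have sep : separated v c Dp Dm by split.
have sep' := separated_sym sep.

(* Convexity of the union *)
have cU : convex_set (Dp `|` Dm).
  apply: (union_convex sep) => // x y t Dpx Dmy /andP[t0 t1].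
  set z := t *: x + _ => zc; apply: contrapT => nDpz.
  have [h hhp hz] : exists2 h, h \in hp & pr z h.1 < h.2.
    apply: contrapT => nh; apply: nDpz; rewrite DpE => h hhp.
    by rewrite leNgt; apply/negP => lt; apply: nh; exists h.
  (* As [eta] minimises [h.1] on [F], evaluation at [h.1] is nonnegative on the local cone of [F] at
     [eta]. *)
  have [eta eF emin] := Fvertex h.1; have [Dpe Dme] := VF _ eF.
  have [e [f [_ CP CQ CF [e0 f0]]]] := mergev _ eF.
  have := mem_local_cone eta Dpx; rewrite CP => /conic_hull_rcons[u ue [a _ xE]].
  have := mem_local_cone eta Dmy; rewrite CQ => /conic_hull_rcons[u' ue' [b _ yE]].
  have zE : z - eta = t *: u + (1 - t) *: u' + (t * a - (1 - t) * b) *: f.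
    have -> : z - eta = t *: (x - eta) + (1 - t) *: (y - eta).
      by rewrite !scalerBr addrACA -opprD -scalerDl [t + _]addrC subrK scale1r.
    rewrite xE yE !scalerDr !scalerA addrACA; congr (_ + _).
    by rewrite scalerBl scalerN.
  (* [z] and [eta] both lie on the hyperplane, so pairing with [v] leaves only the [f] component,
     which must vanish. *)
  have fz : t * a - (1 - t) * b = 0.
    have /(congr1 (fun z => pr z v)) := zE.
    rewrite prB zc (Fc _ (VF _ eF)) !prD !prZ (e0 _ ue) (e0 _ ue').
    rewrite subrr !mulr0 !add0r => /esym/eqP.
    by rewrite mulf_eq0 (gt_eqF f0) orbF => /eqP.
  have : local_cone F eta (z - eta).
    rewrite CF zE fz scale0r addr0.
    by apply: conic_hullD; apply: conic_hullZ => //; rewrite subr_ge0.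
  move=> /(local_cone_ge emin); rewrite prB.
  suff : h.2 <= pr eta h.1 by lra.
  by move: Dpe; rewrite DpE; apply.
have cU' : convex_set (Dm `|` Dp) by rewrite setUC.
have farm : exists2 x, Dm x & pr x v < c.
  exists ym => //; rewrite lt_neqAle Dmc // andbT; apply/eqP => /affv/affv' yc.
  by move: ymc'; rewrite yc ltxx.
have pU := union_polytope pDp pDm cU.
have [hs [hsub UE]] := union_hrep sep cU DpE DmE farp farm.
have rU : rational_polytope exp (Dp `|` Dm).
  split=> //; exists hs; split=> // h /hsub; rewrite mem_cat => /orP[].
    exact: hpZ.
  exact: hmZ.
have fullU : dir (Dp `|` Dm) = fullv.
  apply/eqP; rewrite eqEdim subvf /= -fullp; apply/dimvS/dir_mono.
    by exists x0; case: Fx0.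
  by move=> x; left.

(* Vertices and unimodularity of the union *)
have offp eta : Vert Dp eta -> ~ Vert F eta -> c < pr eta v.
  move=> /[dup] /VertP[Dpe _] eV nF; rewrite lt_neqAle Dpc // andbT eq_sym.
  (* A vertex of [Dp] on the hyperplane lies in the smaller set [F], where the same functional
     exposes it. *)
  apply/eqP => ec; apply: nF; apply: Vert_sub eV; first by move=> x [].
  by rewrite FE.
have offm eta : Vert Dm eta -> ~ Vert F eta -> - c < pr eta (- v).
  move=> /[dup] /VertP[Dme _] eV nF; rewrite prNr ltrN2 lt_neqAle Dmc // andbT.
  apply/eqP => ec; apply: nF; apply: Vert_sub eV; first by move=> x [].
  by split=> //; apply/PQ.
have push eta : Vert F eta -> exists e f (t u : R), [/\ 0 < t, 0 < u,
    weight_lattice exp = Zspan (rcons e f),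
    (forall x, x \in e -> pr x v = 0) /\ 0 < pr f v
    & Dp (eta + t *: f) /\ Dm (eta - u *: f)].
  move=> eF; have [Dpe Dme] := VF _ eF.
  have [e [f [We CP CQ CF [e0 f0]]]] := mergev _ eF; exists e, f.
  have [|t t0 Dpt] := @local_cone_near _ _ Dp eta f cDp Dpe.
    by rewrite CP; apply: sub_conic_hull; rewrite /= mem_rcons mem_head.
  have [|u u0] := @local_cone_near _ _ Dm eta (- f) cDm Dme.
    by rewrite CQ; apply: sub_conic_hull; rewrite /= mem_rcons mem_head.
  rewrite scalerN => Dmu; exists t, u; split=> //; split=> // x xe.
  by apply/e0/sub_conic_hull.
have vertU : Vert (Dp `|` Dm) = (Vert Dp `|` Vert Dm) `\` Vert F.
  apply/seteqP; split=> eta; last first.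
    move=> [[eV|eV] nF]; first exact: union_Vert sep cU (offp _ eV nF) eV.
    by rewrite setUC; apply: union_Vert sep' cU' (offm _ eV nF) eV.
  move=> /[dup] eV /VertP[eU [w wmin]]; split.
    case: eU => eD; [left|right]; apply: Vert_sub eV => // x Dx; by [left|right].
  move=> /push[e [f [t [u [t0 u0 _ [_ f0] [Dpt Dmu]]]]]].
  have moved a : a * pr f v != 0 -> eta + a *: f <> eta.
    move=> af /(congr1 (fun z => pr z v)) /eqP.
    by rewrite prD prZ -subr_eq0 addrAC subrr add0r (negPf af).
  (* Strict minimality at [eta] would make [w] both positive and negative on [f]. *)
  have := wmin _ (or_introl Dpt) (moved _ _); rewrite -scaleNr in Dmu.
  have := wmin _ (or_intror Dmu) (moved _ _).
  rewrite !prD !prZ !ltrDl !mulNr oppr_gt0 oppr_eq0 !mulf_neq0 ?gt_eqF //.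
  rewrite pmulr_rlt0 // pmulr_rgt0 // => /(_ isT) lt /(_ isT) /(lt_trans lt).
  by rewrite ltxx.
have uniU : unimodular exp (Dp `|` Dm).
  (* The directions of both pieces and of the union are the full space, so the lattice basis at a
     vertex of one piece serves unchanged. *)
  split=> // eta; rewrite vertU fullU => -[[eV|eV] nF].
    rewrite (union_local_cone sep cU (offp _ eV nF)); last by have /VertP[] := eV.
    by rewrite -fullp; apply: uVp.
  rewrite setUC (union_local_cone sep' cU' (offm _ eV nF)); last first.
    by have /VertP[] := eV.
  by rewrite -fullm; apply: uVm.

(* The hyperplane of the facet and its transversality *)
split=> //; exists (aff_hull F); split.
- exists (dir F); split; last by apply: dirP; exists x0.
  by have [_ ->] := facetp; rewrite fullp.
- by move=> x Fx; apply/affv/Fc.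
(* The direction [U] of [A'] contains [dir F] and has the same dimension, and both hyperplanes pass
   through [x0]. *)
- move=> A' [U [dU [a A'E]]] FA'.
  have A'x y : A' y <-> y - x0 \in U.
    have [u0 u0U x0E] : [set a + v | v in [set` U]] x0 by rewrite -A'E; apply: FA'.
    rewrite A'E; split=> [[u uU <-]|yU].
      by rewrite -x0E opprD addrACA subrr add0r memvB.
    exists (u0 + (y - x0)); first exact: memvD.
    by rewrite addrA x0E addrC subrK.
  have dFU : dir F = U.
    apply/eqP; rewrite eqEdim; apply/andP; split.
      by apply: (dir_min Fx0) => y /FA' /A'x.
    by rewrite -ltnS dU; have [_ ->] := facetp; rewrite fullp.
  apply/seteqP; split=> y.
    by move=> /A'x; rewrite -dFU => /(aff_hullE _ Fx0).
  by move=> /(aff_hullE _ Fx0); rewrite dFU => /A'x.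
- exists (dir F); split=> //.
  (* Rationality: at any vertex of [F] the weights [e] generate the local cone of [F], hence span
     [dir F]. *)
  + apply/seteqP; split; first by apply: lin_span_sub => x [].
    have [U WU] := lin_span_vspace ([set` dir F] `&` weight_lattice exp).
    have [eta eF _] := Fvertex 0; have [e [f [We _ _ CF [e0 _]]]] := mergev _ eF.
    rewrite -WU; apply/subvP/(dir_min (VF _ eF)) => y Fy.
    have := mem_local_cone eta Fy; rewrite CF; apply: conic_hull_vspace => x xe.
    rewrite WU; apply: sub_lin_span; split; first by apply/dF/e0/sub_conic_hull.
    by rewrite We; apply: Zspan_mem; rewrite mem_rcons inE [_ \in e]xe orbT.
  + by apply: dirP; exists x0.
  + move=> xi [/affv xic Uxi]; rewrite fullU.
    have Fxi : F xi by rewrite FE; split=> //; case: Uxi => // /PQ; apply.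
    apply/seteqP; split=> [_ [x Bx [y [_ Wy] ->]]|_ [x [Bx Wx] [y [_ Wy] ->]]].
      by exists x => //; exists y => //; split=> //; apply: memvf.
    (* [w] cuts out the face of the union with [xi] in its relative interior. As [xi] is in [F], a
       vertex [eta] of [F] minimising [w] lies on that face too. *)
    have [w [wmin wrel]] := hrep_relint_face UE Uxi.
    have [eta eF emin] := Fvertex w.
    have ew : pr eta w = pr xi w.
      by apply/eqP; rewrite eq_le emin //= wmin //; left; case: (VF _ eF).
    have [e [f [t [u [t0 u0 We [e0 f0] [Dpt Dmu]]]]]] := push _ eF.
    have fw : pr f w = 0.
      have := wmin _ (or_introl Dpt); have := wmin _ (or_intror Dmu).
      rewrite prB prD !prZ ew !lerDl oppr_ge0 pmulr_rle0 // pmulr_rge0 //.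
      by move=> le0 ge0; apply/eqP; rewrite eq_le le0.
    have [k yE] : Zspan (rcons e f) y by rewrite -We.
    have Wf : weight_lattice exp f.
      by rewrite We; apply: Zspan_mem; rewrite mem_rcons mem_head.
    rewrite size_rcons big_ord_recr /= nth_rcons ltnn eqxx in yE.
    (* [m] is the coefficient of [f]: the part [y'] spanned by [e] is absorbed by [dir F], and
       [f *~ m] has to come from the tangent span. *)
    set m := k _ in yE; set y' := \sum_(_ < _) _ in yE.
    have y'E : y' = y - f *~ m by rewrite yE addrK.
    exists (x + y'); first split.
    * apply: memvD => //; apply: memv_suml => i _; rewrite nth_rcons ltn_ord.
      by rewrite -scaler_int memvZ //; apply/dF/e0/mem_nth.
    * by rewrite y'E; apply: weight_latticeD => //; apply: weight_latticeB => //;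
        apply: weight_latticeMz.
    exists (f *~ m); last by rewrite yE addrA.
    split; last exact: weight_latticeMz.
    exists ((Dp `|` Dm) `&` [set z | pr z w = pr xi w]); split=> //.
      by split; [exists xi | exists w, (pr xi w)].
    set S := (X in lin_span X); have [U SU] := lin_span_vspace S.
    rewrite -SU /= -scaler_int memvZ //.
    (* [w] vanishes on [f], so [eta + t *: f] is on the face with [eta], and their difference gives
       [f]. *)
    have -> : f = t^-1 *: ((eta + t *: f - xi) - (eta - xi)).
      rewrite opprB addrA subrK addrAC subrr add0r scalerA mulVf ?scale1r //.
      by rewrite gt_eqF.
    have SU' z : S z -> z \in U by move=> /sub_lin_span; rewrite -SU.
    apply/memvZ/memvB; apply: SU'; [exists (eta + t *: f)|exists eta] => //.
      by split; [left|rewrite /= prD prZ fw mulr0 addr0].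
    by split=> //; left; case: (VF _ eF).
Qed.
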